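(* Let $M$ be a matroid on a finite set $S$, and let $T_0\subset T_1\subset\cdots\subset T_k$ be its primary flag. Then the sequence of primary factors $M(T_0,T_1),\dots,M(T_{k-1},T_k)$ is the unique sequence $M_1,\dots,M_k$ of nonempty matroids such that $M=M_1\mathbin{\Box}\cdots\mathbin{\Box} M_k$, each $M_i$ is either irreducible or uniform, and no free product of two or more consecutive $M_i$'s is uniform.
   Context: For a matroid $M$ on $S$ write $\rho_M$ for its rank function, $\rho(M)=\rho_M(S)$, $\nu_M(A)=|A|-\rho_M(A)$, $\lambda_M(A)=\rho(M)-\rho_M(A)$. For matroids $M$ on $S$ and $N$ on $T$ with $S\cap T=\emptyset$, the free product $M\mathbin{\Box} N$ is the matroid on $S\cup T$ whose independent sets are those $A$ with $A\cap S$ independent in $M$ and $\lambda_M(A\cap S)\geq\nu_N(A\cap T)$; it is associative, and ''$M=M_1\mathbin{\Box}\cdots\mathbin{\Box} M_k$'' means equality of matroids on $S$, with the ground sets of the $M_i$ partitioning $S$. A nonempty matroid $M$ is irreducible if every factorization of $M$ as a free product contains $M$ itself as a factor. For $A\subseteq B\subseteq S$, $M(A,B)$ denotes the minor $(M|B)/A$ on $B\setminus A$. A cyclic flat is a flat that is a union of circuits; $\mathcal D(M)$ is the complete sublattice of $2^S$ generated by all cyclic flats of $M$ (it contains $\emptyset$ and $S$). A pinchpoint of a poset is an element comparable to all elements. The primary flag of $M$ is the chain $T_0\subset\cdots\subset T_k$ of all pinchpoints of $\mathcal D(M)$, and the minors $M(T_{i-1},T_i)$ are the primary factors of $M$. 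*)

(* Defs.v *)
From mathcomp Require Import all_boot.
Set Implicit Arguments.
Unset Strict Implicit.
Unset Printing Implicit Defensive.

Section Matroids.
Variable T : finType.

Definition matroid := ({set T} * {set {set T}})%type.
Definition ground (M : matroid) : {set T} := M.1.
Definition indeps (M : matroid) : {set {set T}} := M.2.

Definition is_matroid (M : matroid) : Prop :=
  [/\ forall A : {set T}, A \in indeps M -> A \subset ground M,
      set0 \in indeps M,
      forall A B : {set T}, B \in indeps M -> A \subset B -> A \in indeps M &
      forall A B : {set T}, A \in indeps M -> B \in indeps M -> #|A| < #|B| ->
        exists2 x, x \in B :\: A & x |: A \in indeps M].

Definition rank (M : matroid) (A : {set T}) : nat :=
  \max_(B in indeps M | B \subset A) #|B|.
Definition rk (M : matroid) : nat := rank M (ground M).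
Definition nullity (M : matroid) (A : {set T}) : nat := #|A| - rank M A.
Definition lambda (M : matroid) (A : {set T}) : nat := rk M - rank M A.

(* Free product M [] N on S u T (meaningful for disjoint ground sets). *)
Definition free_product (M N : matroid) : matroid :=
  (ground M :|: ground N,
   [set A in powerset (ground M :|: ground N) |
      (A :&: ground M \in indeps M) &&
      (nullity N (A :&: ground N) <= lambda M (A :&: ground M))]).

Definition empty_matroid : matroid := (set0, [set set0]).

Definition free_product_seq (Ms : seq matroid) : matroid :=
  foldr free_product empty_matroid Ms.

Definition disjoint_grounds (Ms : seq matroid) : bool :=
  pairwise (fun M N => [disjoint ground M & ground N]) Ms.

Definition is_factorization (Ms : seq matroid) (M : matroid) : Prop :=
  [/\ forall N : matroid, N \in Ms -> is_matroid N,
      disjoint_grounds Ms &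
      free_product_seq Ms = M].

Definition irreducible (M : matroid) : Prop :=
  ground M != set0 /\
  forall Ms, is_factorization Ms M -> M \in Ms.

Definition uniform (M : matroid) : Prop :=
  exists r : nat, forall A : {set T},
    (A \in indeps M) = (A \subset ground M) && (#|A| <= r).

(* M(A,B) = (M|B)/A on B \ A : X independent iff rho_M(X u A) = |X| + rho_M(A). *)
Definition minor (M : matroid) (A B : {set T}) : matroid :=
  (B :\: A,
   [set X in powerset (B :\: A) | rank M (X :|: A) == #|X| + rank M A]).

Definition circuit (M : matroid) (C : {set T}) : Prop :=
  [/\ C \subset ground M, C \notin indeps M &
      forall D : {set T}, D \proper C -> D \in indeps M].

Definition flat (M : matroid) (F : {set T}) : Prop :=
  F \subset ground M /\
  forall x : T, x \in ground M :\: F -> rank M F < rank M (x |: F).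

Definition cyclic_flat (M : matroid) (F : {set T}) : Prop :=
  flat M F /\
  forall x : T, x \in F -> exists C : {set T}, [/\ circuit M C, x \in C & C \subset F].

(* D(M): complete sublattice of 2^S generated by the cyclic flats. *)
Inductive in_D (M : matroid) : {set T} -> Prop :=
| D_cyclic F : cyclic_flat M F -> in_D M F
| D_empty : in_D M set0
| D_full : in_D M (ground M)
| D_union X Y : in_D M X -> in_D M Y -> in_D M (X :|: Y)
| D_inter X Y : in_D M X -> in_D M Y -> in_D M (X :&: Y).

Definition pinchpoint (M : matroid) (X : {set T}) : Prop :=
  in_D M X /\ forall Y : {set T}, in_D M Y -> X \subset Y \/ Y \subset X.

Definition primary_flag (M : matroid) (ts : seq {set T}) : Prop :=
  sorted (fun A B : {set T} => A \proper B) ts /\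
  forall X : {set T}, X \in ts <-> pinchpoint M X.

End Matroids.

(* Main.v *)
(* Call a subset A of the ground set a free separator of M if M is the free
   product of M|A and M/A. In terms of ranks this says that
   rho(X) = min (rho(X n A) + |X \ A|, rho(X u A)) for all X, and it holds iff A is
   comparable to every cyclic flat, hence to every member of D(M). Factorizations
   of M as a free product correspond to chains of free separators, the factors
   being the minors between consecutive terms, and M is uniform iff all subsets
   are free separators. If a free separator lies strictly between consecutive
   pinchpoints T < T' then no member of D(M) does, so every set between T and T'
   is a free separator and M(T,T') is uniform; otherwise M(T,T') is irreducible.
   Conversely, a chain of free separators as in the theorem contains every
   pinchpoint (one strictly inside a factor would make that factor uniform, yet
   would then be comparable to every set inside it), and an additional term
   between T and T' would exhibit the uniform M(T,T') as a product of several
   factors. *)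
Require Import Defs.
From mathcomp Require Import all_boot.
From mathcomp Require Import zify.
From Stdlib Require Import Classical.
Set Implicit Arguments.
Unset Strict Implicit.
Unset Printing Implicit Defensive.

(** * Pointwise decision of set identities, and arithmetic of ranks *)

Ltac set_bool z :=
  repeat match goal with
  | H : is_true (_ \subset _) |- _ => move/subsetP/(_ z)/implyP: H
  | H : is_true (in_mem z _) |- _ => move: H
  | H : is_true (~~ in_mem z _) |- _ => move: H
  end;
  rewrite ?inE;
  repeat match goal with
  | |- context [in_mem z ?B] => case: (in_mem z B)
  | |- context [z == ?B] => case: (z == B)
  end => //=.
Ltac set_eq := let z := fresh "z" in apply/setP => z; set_bool z.
Ltac set_sub := let z := fresh "z" in apply/subsetP => z; set_bool z.

Ltac rank_lia :=
  repeat match goal with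
  | H : is_true (_ \subset _) |- _ => clear H
  | H : is_true (in_mem _ _) |- _ => clear H
  | H : is_true (~~ in_mem _ _) |- _ => clear H
  | H : @eq {set _} _ _ |- _ => clear H
  | H : forall _, _ |- _ => clear H
  end; lia.

(** Only [set0] is assumed independent, because this is also applied to the tail of a factorization
    before that tail is known to be a matroid. *)
Lemma rank_attained (T : finType) (M : matroid T) : set0 \in indeps M ->
  forall X : {set T}, exists2 B, B \in indeps M & B \subset X /\ #|B| = rank M X.
Proof.
move=> i0 X; rewrite /rank.
have [|B] := @eq_bigmax_cond _ (fun B => (B \in indeps M) && (B \subset X))
                 (fun B : {set T} => #|B|).
  by apply/card_gt0P; exists set0; rewrite unfold_in /= i0 sub0set.
by rewrite unfold_in /= => /andP[iB sB] ->; exists B.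
Qed.

(** * Rank and minors *)

Section Rank.
Variables (T : finType) (M : matroid T).
Hypothesis matM : is_matroid M.
Implicit Types (A B X Y Z : {set T}).

Lemma indep_sub_ground X : X \in indeps M -> X \subset ground M.
Proof. by case: matM => h _ _ _; apply: h. Qed.

Lemma indep0 : set0 \in indeps M.
Proof. by case: matM. Qed.

Lemma indepS X Y : Y \in indeps M -> X \subset Y -> X \in indeps M.
Proof. by case: matM => _ _ h _; apply: h. Qed.

Lemma indep_card_rank X Y : X \in indeps M -> X \subset Y -> #|X| <= rank M Y.
Proof.
move=> iX sXY; rewrite /rank.
by apply: (leq_bigmax_cond (F := fun B : {set T} => #|B|)); rewrite iX.
Qed.

Lemma rank_basis X : exists2 B, B \in indeps M & B \subset X /\ #|B| = rank M X.
Proof. exact: rank_attained indep0 X. Qed.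

Lemma rank_le_card X : rank M X <= #|X|.
Proof. by have [B _ [/subset_leq_card h <-]] := rank_basis X. Qed.

Lemma rankS X Y : X \subset Y -> rank M X <= rank M Y.
Proof.
move=> sXY; have [B iB [sB <-]] := rank_basis X.
by apply: indep_card_rank => //; apply: subset_trans sXY.
Qed.

Lemma indepE X : (X \in indeps M) = (rank M X == #|X|).
Proof.
apply/idP/eqP => [iX|].
  by apply/eqP; rewrite eqn_leq rank_le_card indep_card_rank.
have [B iB [sB <-]] := rank_basis X => eBX.
by have /eqP <- : B == X by rewrite eqEcard sB eBX leqnn.
Qed.

Lemma basis_extend I X : I \in indeps M -> I \subset X ->
  exists2 B, B \in indeps M & [/\ I \subset B, B \subset X & #|B| = rank M X].
Proof.
move=> iI sI.
have [n] := ubnP (rank M X - #|I|).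
elim: n I iI sI => // n IH I iI sI le_n.
have le_r := indep_card_rank iI sI.
have [eqr|ltr] := eqVneq #|I| (rank M X); first by exists I.
have [B iB [sB eB]] := rank_basis X.
have [_ _ _ exch] := matM.
have [|x] := exch I B iI iB; first by rewrite eB ltn_neqAle ltr.
rewrite inE => /andP[xI xB] ixI.
have [||B' iB' [sB' ? ?]] := IH (x |: I) ixI.
- by rewrite subUset sI sub1set (subsetP sB).
- by rewrite cardsU1 xI; rank_lia.
by exists B' => //; split=> //; apply: subset_trans sB'; apply: subsetUr.
Qed.

(** A basis [I] of the intersection extends to a basis [B] of the union; then count [B] inside [X]
    and inside [Y]. *)
Lemma rank_submod X Y :
  rank M (X :|: Y) + rank M (X :&: Y) <= rank M X + rank M Y.
Proof.
have [I iI [sI eI]] := rank_basis (X :&: Y).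
have [|B iB [sIB sB eB]] := @basis_extend I (X :|: Y) iI.
  by apply: subset_trans sI _; set_sub.
have /indepS iBX := iB.
have h1 : #|B :&: X| <= rank M X by apply: indep_card_rank; rewrite ?subsetIr ?iBX ?subsetIl.
have h2 : #|B :&: Y| <= rank M Y by apply: indep_card_rank; rewrite ?subsetIr ?iBX ?subsetIl.
have h3 := cardsUI (B :&: X) (B :&: Y).
have e1 : (B :&: X) :|: (B :&: Y) = B by set_eq.
have h4 : #|I| <= #|(B :&: X) :&: (B :&: Y)| by apply: subset_leq_card; set_sub.
rewrite e1 in h3; rank_lia.
Qed.

Lemma rankU_card X Y : rank M (X :|: Y) <= rank M X + #|Y|.
Proof. have := rank_submod X Y; have := rank_le_card Y; rank_lia. Qed.

(** Submodularity for [Y] and [X :|: Z], whose intersection contains [X]. It serves to replace a set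
    by one of its bases. *)
Lemma rankU_eq X Y Z : X \subset Y -> rank M Y <= rank M X ->
  rank M (Y :|: Z) <= rank M (X :|: Z).
Proof.
move=> sXY le; have := rank_submod Y (X :|: Z).
have -> : Y :|: (X :|: Z) = Y :|: Z by set_eq.
have : rank M X <= rank M (Y :&: (X :|: Z)) by apply: rankS; set_sub.
rank_lia.
Qed.

(** The additive form avoids truncated subtraction. For the lower bound, extend a basis of [A] to a
    basis [K] of [X :|: A]; then [K :\: A] is independent in the minor. *)
Lemma rank_minor A B X : X \subset B :\: A ->
  rank (minor M A B) X + rank M A = rank M (X :|: A).
Proof.
move=> sX; apply/eqP; rewrite eqn_leq; apply/andP; split.
  suff : rank (minor M A B) X <= rank M (X :|: A) - rank M A.
    have := @rankS A (X :|: A); rewrite subsetUr => /(_ isT); rank_lia.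
  apply/bigmax_leqP => Z; rewrite inE => /andP[/andP[_ /eqP eZ] sZ].
  have : rank M (Z :|: A) <= rank M (X :|: A) by apply/rankS/setSU.
  rank_lia.
have [J iJ [sJ eJ]] := rank_basis A.
have [|K iK [sJK sK eK]] := @basis_extend J (X :|: A) iJ.
  by apply: subset_trans sJ (subsetUr _ _).
have cKA : #|K :&: A| <= rank M A.
  by apply: indep_card_rank (subsetIr _ _); apply: indepS iK (subsetIl _ _).
have cK := cardsID A K.
have le : rank M A <= #|K :&: A| by rewrite -eJ; apply: subset_leq_card; set_sub.
suff : #|K :\: A| <= rank (minor M A B) X by rank_lia.
apply: (leq_bigmax_cond (F := fun B : {set T} => #|B|)).
have sKX : K :\: A \subset X by set_sub.
rewrite sKX andbT inE powersetE (subset_trans sKX sX) /=.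
have sU := rankU_card A (K :\: A); rewrite setUC in sU.
have : #|K| <= rank M (K :\: A :|: A) by apply: indep_card_rank => //; set_sub.
rank_lia.
Qed.

Lemma mem_indeps_minor A B X : X \subset B :\: A -> X \in indeps (minor M A B) =
   (rank M (X :|: A) == #|X| + rank M A).
Proof. by move=> sX; rewrite inE powersetE sX. Qed.

Lemma minor_matroid A B : is_matroid (minor M A B).
Proof.
split=> [X||X Y|X Y].
- by rewrite inE powersetE => /andP[].
- by rewrite inE powersetE sub0set set0U cards0 eqxx.
- rewrite inE powersetE => /andP[sY /eqP eY] sXY.
  rewrite inE powersetE (subset_trans sXY sY) /=.
  have := rankU_card A X; have := rankU_card (X :|: A) (Y :\: X).
  have -> : X :|: A :|: Y :\: X = Y :|: A by set_eq.
  have := cardsID X Y; have := subset_leq_card sXY; rewrite (setUC A).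
  have -> : Y :&: X = X by set_eq.
  rank_lia.
have [J iJ [sJ eJ]] := rank_basis A.
(* Adjoining a fixed basis [J] of [A] turns independence in the minor into independence in [M], so
   exchange is inherited from [X :|: J] and [Y :|: J]. *)
have key Z : Z \in indeps (minor M A B) ->
    Z :|: J \in indeps M /\ #|Z :|: J| = #|Z| + rank M A.
  rewrite inE powersetE => /andP[sZ /eqP eZ].
  have dZ : [disjoint Z & J].
    by rewrite -setI_eq0 -subset0; set_sub.
  have e : #|Z :|: J| = #|Z| + rank M A.
    by rewrite cardsU (disjoint_setI0 dZ) cards0 subn0 eJ.
  split=> //; rewrite indepE eqn_leq rank_le_card e -eZ /= setUC (setUC Z).
  by apply: rankU_eq => //; rewrite -eJ; apply: indep_card_rank.
move=> iX iY ltXY; have [iX' cX] := key _ iX; have [iY' cY] := key _ iY.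
have [_ _ _ exch] := matM.
have [|x xY ix] := exch _ _ iX' iY'; first by rank_lia.
have {}xY : x \in Y :\: X.
  move: xY; rewrite !inE; case: (x \in J); case: (x \in X); case: (x \in Y) => //.
exists x => //.
have sY : Y \subset B :\: A by move: iY; rewrite inE powersetE => /andP[].
have sX : X \subset B :\: A by move: iX; rewrite inE powersetE => /andP[].
have xX : x \notin X by move: xY; rewrite inE => /andP[].
have sxX : x |: X \subset B :\: A.
  by rewrite subUset sub1set sX andbT; apply: (subsetP sY); move: xY; rewrite inE => /andP[].
rewrite mem_indeps_minor // eqn_leq addnC setUC rankU_card /=.
have xXJ : x \notin X :|: J.
  apply/negP; move: xY; rewrite !inE => /andP[/negbTE -> xY] /= xJ.
  have := subsetP sJ _ xJ; have := subsetP sY _ xY; rewrite inE => /andP[/negbTE ->] //.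
have : #|x |: (X :|: J)| <= rank M (A :|: (x |: X)).
  apply: indep_card_rank => //; set_sub.
by rewrite !cardsU1 xXJ xX cX addnA (addnC (rank M A)).
Qed.

End Rank.

(** * Free separators *)

(* The rank form of M = M|A [] M/A. *)
Definition free_separator (T : finType) (M : matroid T) (A : {set T}) : Prop :=
  A \subset ground M /\
  forall X : {set T}, X \subset ground M ->
    rank M (X :|: A) <= rank M X \/ rank M (X :&: A) + #|X :\: A| <= rank M X.

Section FreeSeparator.
Variables (T : finType) (M : matroid T).
Hypothesis matM : is_matroid M.
Implicit Types (A B C F X Y Z : {set T}).

Lemma free_separator_indep A X : free_separator M A -> X \subset ground M ->
  X :&: A \in indeps M -> #|X| <= rank M (X :|: A) -> X \in indeps M.
Proof.
move=> [_ fA] sX; rewrite !indepE // => /eqP iXA leX.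
rewrite eqn_leq rank_le_card //=; have := cardsID A X.
by case: (fA X sX) => *; rank_lia.
Qed.

(** If both alternatives fail for [X], extend a basis of [X :&: A] to a basis [B'] of [X]. By
    counting, [B'] misses some [x] of [X :\: A], and the hypothesis makes [x |: B'] independent,
    contradicting the rank of [X]. *)
Lemma free_separatorI A : A \subset ground M ->
  (forall X, X \subset ground M -> X :&: A \in indeps M ->
     #|X| <= rank M (X :|: A) -> X \in indeps M) ->
  free_separator M A.
Proof.
move=> sA fA; split=> // X sX.
have [|lt1] := leqP (rank M (X :|: A)) (rank M X); first by left.
right; rewrite leqNgt; apply/negP => lt2.
have [B iB [sB eB]] := rank_basis matM (X :&: A).
have [|B' iB' [sBB' sB' eB']] := @basis_extend _ _ matM B X iB.
  by apply: subset_trans sB (subsetIl _ _).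
have B'A : #|B| <= #|B' :&: A| by apply: subset_leq_card; set_sub.
have cB' := cardsID A B'.
have /subsetPn[x xX xB'] : ~~ (X :\: A \subset B' :\: A).
  by apply/negP => /subset_leq_card; rank_lia.
have [xA {}xX] : x \notin A /\ x \in X by move: xX; rewrite inE => /andP.
have {}xB' : x \notin B' by move: xB'; rewrite inE xA.
have sxX : x |: B' \subset X by rewrite subUset sub1set xX sB'.
have ix : x |: B' \in indeps M.
  apply: fA.
  - exact: subset_trans sX.
  - apply: (indepS matM iB'); apply/subsetP => z; rewrite !inE => /andP[/orP[/eqP ->|//]].
    by rewrite (negbTE xA).
  rewrite cardsU1 xB' eB' add1n; apply: (leq_trans lt1).
  apply: leq_trans (rankU_eq matM A sB' _) _; first by rewrite -eB' indep_card_rank.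
  by apply: rankS => //; apply: setSU; apply: subsetUr.
have := indep_card_rank ix sxX.
by rewrite cardsU1 xB' eB' add1n ltnn.
Qed.

(** * Circuits, closures and comparability with D(M) *)

Lemma dependent_circuit X : X \subset ground M -> X \notin indeps M ->
  exists2 C, circuit M C & C \subset X.
Proof.
move=> sX dX; have [C /minsetP[dC minC] sC] := @minset_exists _ (fun Y => Y \notin indeps M) X dX.
exists C => //; split=> // [|D]; first exact: subset_trans sX.
rewrite properEneq => /andP[neD sD]; apply: contraNT neD => dD.
by rewrite (minC D).
Qed.

Lemma circuit_rank C : circuit M C ->
  exists2 c, c \in C & C :\ c \in indeps M /\ rank M C = #|C :\ c|.
Proof.
move=> [sC dC minC].
have [e|[c cC]] := set_0Vmem C; first by case/negP: dC; rewrite e indep0.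
have iC : C :\ c \in indeps M by apply: minC; rewrite properD1.
exists c => //; split=> //.
have := cardsD1 c C; rewrite cC => eC.
have := rank_le_card matM C; have := indep_card_rank iC (subsetDl _ _).
by have : rank M C != #|C|; [rewrite -indepE | rank_lia].
Qed.

(** If the rank grew, exchange would enlarge a basis of [C] by a single element of [X :|: C]. *)
Lemma rank_closure C X : (forall x, x \in X -> rank M (x |: C) <= rank M C) ->
  rank M (X :|: C) <= rank M C.
Proof.
move=> clX; rewrite leqNgt; apply/negP => lt.
have [B iB [sB eB]] := rank_basis matM C.
have [I iI [sI eI]] := rank_basis matM (X :|: C).
have [_ _ _ exch] := matM.
have [|x] := exch B I iB iI; first by rewrite eB eI.
rewrite inE => /andP[xB xI] ix.
have : rank M (x |: C) <= rank M C.
  have := subsetP sI x xI; rewrite inE => /orP[/clX //|xC].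
  by rewrite (setUidPr _) // sub1set.
have := indep_card_rank ix (setUS _ sB).
by rewrite cardsU1 xB; rank_lia.
Qed.

Definition closure C := [set x in ground M | rank M (x |: C) <= rank M C].

(** For [x] in the closure but outside [C], remove some [c] from [C]: adding [x] to the independent
    rest gives a dependent set, and any circuit in it must contain [x]. *)
Lemma circuit_closure C : circuit M C -> cyclic_flat M (closure C).
Proof.
move=> cC; have [sC dC minC] := cC.
have sCF : C \subset closure C.
  by apply/subsetP => x xC; rewrite inE (subsetP sC) //= (setUidPr _) // sub1set.
have rF : rank M (closure C) <= rank M C.
  rewrite -[closure C](setUidPl sCF); apply: rank_closure => x.
  by rewrite inE => /andP[].
split.
  split; first by apply/subsetP => x; rewrite inE => /andP[].
  move=> x; rewrite !inE negb_and andb_orl => /orP[/andP[/negbTE ->//]|/andP[]].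
  rewrite -ltnNge => lt _; apply: leq_ltn_trans rF (leq_trans lt _).
  by apply: rankS => //; apply: setUS.
move=> x xF; have [xC|xC] := boolP (x \in C); first by exists C.
have [c cC' [iCc eCc]] := circuit_rank cC.
have [xg rx] : x \in ground M /\ rank M (x |: C) <= rank M C by apply/andP; move: xF; rewrite inE.
have sD : C :\ c \subset C by apply: subsetDl.
have xCc : x \notin C :\ c by apply: contra xC => /(subsetP sD).
have [D cD sDx] : exists2 D, circuit M D & D \subset x |: (C :\ c).
  apply: dependent_circuit; first by rewrite subUset sub1set xg (subset_trans sD sC).
  apply/negP => ix; have := indep_card_rank ix (setUS _ sD).
  by rewrite cardsU1 xCc -eCc; rank_lia.
exists D; split=> //.
  apply: contraT => xD; have [_ dD _] := cD; case/negP: dD; apply: (indepS matM iCc).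
  apply/subsetP => z zD; have := subsetP sDx z zD; rewrite in_setU1 => /orP[/eqP ez|//].
  by rewrite -ez zD in xD.
apply: subset_trans sDx _; rewrite subUset sub1set xF /=.
exact: subset_trans sCF.
Qed.

Lemma in_D_sub_ground X : in_D M X -> X \subset ground M.
Proof.
elim=> [F [[]]//|||Y Z _ sY _ sZ|Y Z _ sY _ sZ] //; first exact: sub0set.
  by rewrite subUset sY.
by apply: subset_trans sY; apply: subsetIl.
Qed.

(** Suppose a cyclic flat [F] misses [a] of [A] and has an element [x] outside [A]. Take a circuit
    [C] through [x] inside [F], and apply the separator property to [C]: one alternative puts [a] in
    the span of [F], the other makes [C] independent. Comparability then passes to unions and
    intersections. *)
Lemma free_separator_comparable A : free_separator M A ->
  forall X, in_D M X -> A \subset X \/ X \subset A.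
Proof.
move=> [sA fA] X; elim=> [F [[sF flF] cF]|||Y Z _ hY _ hZ|Y Z _ hY _ hZ].
- have [|/subsetPn[a aA aF]] := boolP (A \subset F); first by left.
  right; apply/subsetP => x xF; apply: contraT => xA.
  have [C [cC xC sCF]] := cF x xF; have [sC dC minC] := cC.
  have iCA : C :&: A \in indeps M.
    apply: minC; rewrite properE subsetIl /=.
    by apply/subsetPn; exists x; rewrite // inE (negbTE xA) andbF.
  have [le|le] := fA C sC.
    have := flF a; rewrite inE aF (subsetP sA) // => /(_ isT).
    have := rank_submod matM (a |: C) F.
    have -> : a |: C :|: F = a |: F by rewrite -setUA (setUidPr sCF).
    have : rank M C <= rank M ((a |: C) :&: F).
      by apply: rankS; rewrite // subsetI subsetUr.
    have : rank M (a |: C) <= rank M (C :|: A).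
      by apply: rankS; rewrite // setUC setUS // sub1set.
    rank_lia.
  case/negP: dC; rewrite indepE // eqn_leq rank_le_card //=.
  by rewrite -(cardsID A C); move: iCA; rewrite indepE // => /eqP <-.
- by right; apply: sub0set.
- by left.
- case: hY => hY; first by left; apply: subset_trans hY (subsetUl _ _).
  case: hZ => hZ; first by left; apply: subset_trans hZ (subsetUr _ _).
  by right; rewrite subUset hY.
- case: hY => hY; last by right; apply: subset_trans (subsetIl _ _) hY.
  case: hZ => hZ; last by right; apply: subset_trans (subsetIr _ _) hZ.
  by left; rewrite subsetI hY.
Qed.

(** A dependent [X] contains a circuit [C]. If [A] lies in the closure of [C], it adds no rank to
    [X], so [X] has full rank; if the closure lies in [A], then [C] is part of the independent set
    [X :&: A]. *)
Lemma comparable_free_separator A : A \subset ground M ->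
  (forall X, in_D M X -> A \subset X \/ X \subset A) -> free_separator M A.
Proof.
move=> sA cmpA; apply: free_separatorI => // X sX iXA leX.
apply: contraT => dX; have [C cC sCX] := dependent_circuit sX dX.
have [sC dC minC] := cC.
have sCF : C \subset closure C.
  by apply/subsetP => x xC; rewrite inE (subsetP sC) //= (setUidPr _) // sub1set.
case: (cmpA _ (D_cyclic (circuit_closure cC))) => [sAF|sFA].
  have : rank M (A :|: C) <= rank M C.
    by apply: rank_closure => x /(subsetP sAF); rewrite inE => /andP[].
  move/(rankU_eq matM X (subsetUr _ _)).
  have -> : C :|: X = X by apply/setUidPr.
  have -> : A :|: C :|: X = X :|: A by rewrite -setUA (setUidPr sCX) setUC.
  by move=> le; case/negP: dX; rewrite indepE // eqn_leq rank_le_card //= (leq_trans leX).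
case/negP: dC; apply: (indepS matM iXA).
by rewrite subsetI sCX (subset_trans sCF).
Qed.

(** * Free separators in uniform matroids and in minors *)

Lemma uniform_free_separator A : uniform M -> A \subset ground M -> free_separator M A.
Proof.
move=> [r rP] sA; apply: free_separatorI => // X sX _ le.
rewrite rP sX /=; apply: leq_trans le _.
by have [B] := rank_basis matM (X :|: A); rewrite rP => /andP[_ le] [_ <-].
Qed.

(* Apply the separator property of [ground M :\: X] to [X]. *)
Lemma free_separator_uniform :
  (forall A, A \subset ground M -> free_separator M A) -> uniform M.
Proof.
move=> allA; exists (rk M) => X; apply/idP/andP => [iX|[sX leX]].
  by have sX := indep_sub_ground matM iX; rewrite sX indep_card_rank.
have := @free_separator_indep (ground M :\: X) X (allA _ (subsetDl _ _)) sX.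
have -> : X :&: (ground M :\: X) = set0 by set_eq.
have -> : X :|: (ground M :\: X) = ground M by set_eq.
by rewrite indep0 //; apply.
Qed.

Lemma free_separator_minor A B C : free_separator M B -> A \subset B -> B \subset C ->
  C \subset ground M -> free_separator (minor M A C) (B :\: A).
Proof.
move=> [_ fB] sAB sBC sC; split=> [|X sX]; first exact: setSD.
have := fB (X :|: A).
have -> : X :|: A :|: B = X :|: B by set_eq.
have -> : (X :|: A) :&: B = X :&: (B :\: A) :|: A by set_eq.
have -> : (X :|: A) :\: B = X :\: (B :\: A) by set_eq.
have r1 := rank_minor matM sX.
have s2 : X :|: (B :\: A) \subset C :\: A by rewrite subUset sX setSD.
have s3 : X :&: (B :\: A) \subset C :\: A by apply: subset_trans sX; apply: subsetIl.
have r2 := rank_minor matM s2; have r3 := rank_minor matM s3.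
have e : X :|: (B :\: A) :|: A = X :|: B by set_eq.
rewrite e in r2.
case=> [|le|le]; first by set_sub.
  by left; rank_lia.
by right; rank_lia.
Qed.

(** The property of [C] reduces an arbitrary set to its part inside [C]; there, the property of [A]
    either settles the claim or allows passing to the minor. *)
Lemma minor_free_separator A C U : free_separator M A -> free_separator M C -> A \subset C ->
  free_separator (minor M A C) U -> free_separator M (A :|: U).
Proof.
move=> [sA fA] [sC fC] sAC [sU fU]; rewrite /= in sU fU.
have sAUC : A :|: U \subset C by rewrite subUset sAC (subset_trans sU (subsetDl _ _)).
split=> [|X sX]; first exact: subset_trans sC.
have within Y : Y \subset C -> rank M (Y :|: (A :|: U)) <= rank M Y \/
    rank M (Y :&: (A :|: U)) + #|Y :\: (A :|: U)| <= rank M Y.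
  move=> sY; have [leA|leA] := fA Y (subset_trans sY sC); last first.
    right; have := cardsID U (Y :\: A).
    have := rankU_card matM (Y :&: A) ((Y :\: A) :&: U).
    have -> : Y :&: A :|: (Y :\: A) :&: U = Y :&: (A :|: U) by set_eq.
    have -> : Y :\: A :\: U = Y :\: (A :|: U) by set_eq.
    by rank_lia.
  have sYA : Y :\: A \subset C :\: A by apply: setSD.
  have s2 : Y :\: A :|: U \subset C :\: A by rewrite subUset sYA.
  have s3 : (Y :\: A) :&: U \subset C :\: A by apply: subset_trans sYA; apply: subsetIl.
  have r1 := rank_minor matM sYA; have r2 := rank_minor matM s2; have r3 := rank_minor matM s3.
  have e1 : Y :\: A :|: A = Y :|: A by set_eq.
  have e2 : Y :\: A :|: U :|: A = Y :|: (A :|: U) by set_eq.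
  have e3 : Y :\: A :\: U = Y :\: (A :|: U) by set_eq.
  have le3 : rank M (Y :&: (A :|: U)) <= rank M ((Y :\: A) :&: U :|: A).
    by apply: rankS => //; set_sub.
  have := fU _ sYA; rewrite e3; rewrite e1 in r1; rewrite e2 in r2.
  by case=> le; [left|right]; rank_lia.
have [leC|leC] := fC X sX.
  left; apply: leq_trans leC; apply: rankS => //; exact: setUS.
have [|le|le] := within (X :&: C); first exact: subsetIr.
  left; have := rankU_card matM (X :&: C :|: (A :|: U)) (X :\: C).
  have -> : X :&: C :|: (A :|: U) :|: X :\: C = X :|: (A :|: U) by set_eq.
  rank_lia.
right; have := cardsID C (X :\: (A :|: U)).
have -> : (X :\: (A :|: U)) :&: C = X :&: C :\: (A :|: U) by set_eq.
have -> : X :\: (A :|: U) :\: C = X :\: C by set_eq.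
have e : X :&: C :&: (A :|: U) = X :&: (A :|: U) by set_eq.
rewrite e in le; rank_lia.
Qed.

(** Given that the part of [X] in [B] is independent in [minor M A B], the condition on [lambda] and
    [nullity] says that |X| + rank(A) is at most the rank of [X :|: B]. *)
Lemma free_product_minors A B C : free_separator M B -> A \subset B -> B \subset C ->
  C \subset ground M -> free_product (minor M A B) (minor M B C) = minor M A C.
Proof.
move=> fB sAB sBC sC; rewrite /free_product /=.
have eg : B :\: A :|: C :\: B = C :\: A by set_eq.
rewrite [RHS]/minor eg; congr (_, _); apply/setP => X; rewrite [in LHS]inE [in RHS]inE.
case: (boolP (X \in powerset _)) => //=; rewrite powersetE => sX.
have sY : X :&: (B :\: A) \subset B :\: A by apply: subsetIr.
have sZ : X :&: (C :\: B) \subset C :\: B by apply: subsetIr.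
rewrite mem_indeps_minor // /lambda /nullity /rk.
have rY := rank_minor matM sY; have rZ := rank_minor matM sZ.
have rg := rank_minor matM (subxx (B :\: A)).
have eB : B :\: A :|: A = B by set_eq.
have eZ : X :&: (C :\: B) :|: B = X :|: B by set_eq.
rewrite eB in rg; rewrite eZ in rZ.
have cX : #|X| = #|X :&: (B :\: A)| + #|X :&: (C :\: B)|.
  rewrite -(cardsID B X); have -> : X :&: B = X :&: (B :\: A) by set_eq.
  by have -> : X :\: B = X :&: (C :\: B) by set_eq.
have sub1 : rank M (X :|: A) <= rank M (X :&: (B :\: A) :|: A) + #|X :&: (C :\: B)|.
  have := rankU_card matM (X :&: (B :\: A) :|: A) (X :&: (C :\: B)).
  by have -> : X :&: (B :\: A) :|: A :|: X :&: (C :\: B) = X :|: A by set_eq.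
have sub2 := rankU_card matM A (X :&: (B :\: A)); rewrite setUC in sub2.
have sub3 : rank M (X :|: A) <= rank M (X :|: B) by apply: rankS => //; apply: setUS.
(* [sub4] and [sub5] make the truncated subtractions in [lambda] and [nullity] exact. *)
have sub4 : rank M (X :&: (B :\: A) :|: A) <= rank M B.
  by apply: rankS => //; set_sub.
have sub5 : rank M (X :|: B) <= rank M B + #|X :&: (C :\: B)|.
  by rewrite -eZ setUC rankU_card.
rewrite [ground (minor M A B)]/=.
apply/andP/eqP => [[/eqP eY le]|eX]; last first.
  by split; first (apply/eqP; rank_lia); rank_lia.
(* Replace [A] by a basis [J]: then [X :|: J] has size |X| + rank(A), and [free_separator_indep] for
   [B] makes it independent in [M]. *)
have [J iJ [sJ eJ]] := rank_basis matM A.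
have dXJ : #|X :|: J| = #|X| + rank M A.
  rewrite cardsU; have -> : X :&: J = set0 by set_eq.
  by rewrite cards0 subn0 eJ.
have rJ Z : rank M (Z :|: A) = rank M (Z :|: J).
  apply/eqP; rewrite eqn_leq (@rankS _ _ matM (Z :|: J)) ?setUS // andbT.
  by rewrite setUC (setUC Z); apply: rankU_eq => //; rewrite -eJ indep_card_rank.
suff : X :|: J \in indeps M.
  by rewrite indepE // => /eqP; rewrite rJ dXJ.
have sAC := subset_trans sAB sBC.
have sJB : J \subset B by apply: subset_trans sAB.
apply: free_separator_indep fB _ _ _.
- by apply: subset_trans sC; set_sub.
- have -> : (X :|: J) :&: B = X :&: (B :\: A) :|: J by set_eq.
  rewrite indepE // -rJ eY eqn_leq cardsU.
  have -> : X :&: (B :\: A) :&: J = set0 by set_eq.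
  by rewrite cards0 eJ; rank_lia.
have -> : X :|: J :|: B = X :|: B by set_eq.
rewrite dXJ; rank_lia.
Qed.
End FreeSeparator.

(** * Free products and chains of free separators *)

Section Products.
Variable T : finType.
Implicit Types (M N P Q : matroid T) (A B C U V W X Y : {set T}).
Implicit Types (vs : seq {set T}) (Ms : seq (matroid T)).

Lemma minor_minor M A C U W : is_matroid M -> U \subset W -> W \subset C :\: A ->
  minor (minor M A C) U W = minor M (A :|: U) (A :|: W).
Proof.
move=> matM sUW sW; rewrite [LHS]/minor [RHS]/minor.
have -> : (A :|: W) :\: (A :|: U) = W :\: U by set_eq.
congr (_, _); apply/setP => X; rewrite !inE.
case: (boolP (X \subset _)) => //= sX.
have s1 : X :|: U \subset C :\: A by set_sub.
have r1 := rank_minor matM s1; have r2 := rank_minor matM (subset_trans sUW sW).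
have e : X :|: U :|: A = X :|: (A :|: U) by set_eq.
rewrite e in r1; rewrite setUC in r2.
by apply/eqP/eqP; rank_lia.
Qed.

Lemma minor_ground M : is_matroid M -> minor M set0 (ground M) = M.
Proof.
move=> matM; case: M matM => G I matM; rewrite /minor /= setD0; congr (_, _).
apply/setP => X; rewrite inE powersetE setU0.
have -> : rank (G, I) set0 = 0 by apply/eqP; rewrite -leqn0 -[0](cards0 T) rank_le_card.
rewrite addn0 -[rank _ _ == _](indepE matM); apply: andb_idl => /(indep_sub_ground matM) //.
Qed.

(** The assumptions on [Q] are weak because [Q] will be the product of all later factors; that it is
    a matroid follows from its being a minor. *)
Lemma free_product_factors M P Q : is_matroid M -> is_matroid P ->
  set0 \in indeps Q -> (forall X, X \in indeps Q -> X \subset ground Q) ->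
  [disjoint ground P & ground Q] -> free_product P Q = M ->
  [/\ P = minor M set0 (ground P), Q = minor M (ground P) (ground M) &
      free_separator M (ground P)].
Proof.
move=> matM matP i0Q sQ dPQ eM.
have /eqP dPQ0 : ground P :&: ground Q == set0 by rewrite setI_eq0.
have eg : ground M = ground P :|: ground Q by rewrite -eM.
have sPQ : ground P \subset ~: ground Q by rewrite -disjoints_subset.
have iM X : (X \in indeps M) = (X \subset ground P :|: ground Q) &&
    ((X :&: ground P \in indeps P) &&
     (#|X :&: ground Q| - rank Q (X :&: ground Q) <= rk P - rank P (X :&: ground P))).
  by rewrite -eM inE powersetE.
have iP X : X \subset ground P -> (X \in indeps M) = (X \in indeps P).
  move=> sX; rewrite iM (subset_trans sX (subsetUl _ _)) (setIidPl sX) /=.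
  have -> : X :&: ground Q = set0 by set_eq.
  by rewrite cards0 sub0n andbT.
have rP X : X \subset ground P -> rank M X = rank P X.
  move=> sX; apply: eq_bigl => B; apply: andb_id2r => sB.
  by apply: iP; apply: subset_trans sX.
have r0 N : is_matroid N -> rank N set0 = 0.
  by move=> matN; apply/eqP; rewrite -leqn0 -[0](cards0 T) rank_le_card.
have eP : P = minor M set0 (ground P).
  rewrite /minor setD0; case: P rP iP matP {iM sPQ eg dPQ dPQ0 eM} => G I /= rP iP matP.
  congr (_, _); apply/setP => X; rewrite inE powersetE setU0 r0 // addn0.
  have [sX|sX] := boolP (X \subset G); first by rewrite rP //= -indepE.
  by apply: contraNF sX; apply: indep_sub_ground matP _.
have eQ : Q = minor M (ground P) (ground M).
  have eI Y : (Y \in indeps Q) = (Y \subset ground Q) &&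
      (rank M (Y :|: ground P) == #|Y| + rank M (ground P)).
    rewrite (rP (ground P)) //.
    apply/idP/andP => [iY|[sY /eqP eY]].
      have sY := sQ Y iY; split=> //.
      have [J iJ [sJ eJ]] := rank_basis matP (ground P).
      have iJY : J :|: Y \in indeps M.
        rewrite iM; have -> : (J :|: Y) :&: ground P = J by set_eq.
        have -> : (J :|: Y) :&: ground Q = Y by set_eq.
        rewrite iJ setUSS //=; have := indep_card_rank iY (subxx _).
        by rewrite -subn_eq0 => /eqP ->.
      have : #|J :|: Y| <= rank M (Y :|: ground P).
        by apply: indep_card_rank; rewrite // setUC setUS.
      have := rankU_card matM (ground P) Y; rewrite (rP (ground P)) // setUC cardsU.
      have -> : J :&: Y = set0 by set_eq.
      by rewrite cards0 eJ => ? ?; apply/eqP; rank_lia.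
    (* The size of this basis forces it to contain all of [Y] and [rk P] elements of [ground P].
       Then [lambda] is 0, so [Y] has nullity 0 in [Q]. *)
    have [X iX [sX eX]] := rank_basis matM (Y :|: ground P).
    move: (iX); rewrite iM => /and3P[sXg iXP].
    have -> : rank P (X :&: ground P) = #|X :&: ground P|.
      by apply/eqP; rewrite -indepE.
    have leP : #|X :&: ground P| <= rk P by apply: indep_card_rank (subsetIr _ _).
    have eXQ : X :\: ground P = X :&: ground Q by set_eq.
    have := cardsID (ground P) X; rewrite eXQ.
    have sXY : X :&: ground Q \subset Y by set_sub.
    have leY := subset_leq_card sXY.
    rewrite eX eY -/(rk P) => cX le.
    have eXY : X :&: ground Q = Y by apply/eqP; rewrite eqEcard sXY /=; rank_lia.
    rewrite eXY in cX le.
    have [B iB [sB eB]] := rank_attained i0Q Y.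
    suff /eqP <- : B == Y by [].
    by rewrite eqEcard sB eB /=; rank_lia.
  rewrite /minor eg; have -> : (ground P :|: ground Q) :\: ground P = ground Q by set_eq.
  case: Q eI {iM eM eg dPQ dPQ0 sPQ sQ i0Q} => G I /= eI; congr (_, _).
  by apply/setP => Y; rewrite inE powersetE eI.
split=> //; apply: free_separatorI => //; first by rewrite eg subsetUl.
move=> X sX iX leX; rewrite iM -eg sX -iP ?subsetIr // iX /=.
have -> : rank P (X :&: ground P) = #|X :&: ground P|.
  by apply/eqP; rewrite -indepE // -iP ?subsetIr.
have sXQ : X :&: ground Q \subset ground M :\: ground P by rewrite eg; set_sub.
have := rank_minor matM sXQ; rewrite -eQ.
have -> : X :&: ground Q :|: ground P = X :|: ground P by rewrite eg in sX; set_eq.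
have := cardsID (ground P) X.
have -> : X :\: ground P = X :&: ground Q by rewrite eg in sX; set_eq.
by rewrite (rP (ground P)) // -/(rk P); rank_lia.
Qed.

Lemma free_product_seq_indep0 Ms : (forall N, N \in Ms -> is_matroid N) ->
  set0 \in indeps (free_product_seq Ms).
Proof.
case: Ms => [|N Ms] matMs; first by rewrite inE.
have matN := matMs N (mem_head _ _).
by rewrite inE powersetE sub0set !set0I indep0 // /nullity cards0 sub0n.
Qed.

Lemma free_product_seq_indep_sub Ms X : X \in indeps (free_product_seq Ms) ->
  X \subset ground (free_product_seq Ms).
Proof.
case: Ms => [|N Ms]; first by rewrite inE => /eqP ->; apply: sub0set.
by rewrite inE powersetE => /andP[].
Qed.

Lemma disjoint_free_product_seq N Ms : disjoint_grounds (N :: Ms) ->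
  [disjoint ground N & ground (free_product_seq Ms)].
Proof.
rewrite /disjoint_grounds /= => /andP[+ _]; elim: Ms => [|P Ms IH] /=.
  by move=> _; rewrite -setI_eq0 setI0.
case/andP=> dP /IH; rewrite -!setI_eq0 setIUr setU_eq0 => -> //.
by rewrite setI_eq0 dP.
Qed.

Lemma free_separator_ground M : free_separator M (ground M).
Proof.
split=> // X sX; right; rewrite (setIidPl sX).
by have -> : X :\: ground M = set0 by [apply/eqP; rewrite setD_eq0]; rewrite cards0 addn0.
Qed.

Lemma free_separator0 M : free_separator M set0.
Proof. by split=> [|X _]; [apply: sub0set | left; rewrite setU0]. Qed.

(** Inclusions are not strict: an empty factor of a factorization appears as a repeated term. *)
Definition subchain := path (fun A B : {set T} => A \subset B).

Lemma subchain_last A vs : subchain A vs -> A \subset last A vs.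
Proof.
elim: vs A => //= B vs IH A /andP[sAB /IH]; exact: subset_trans.
Qed.

Lemma free_product_seq_minors M A vs : is_matroid M -> subchain A vs ->
  (forall V, V \in vs -> free_separator M V) ->
  free_product_seq (pairmap (minor M) A vs) = minor M A (last A vs).
Proof.
move=> matM; elim: vs A => [A _ _|B vs IH A /= /andP[sAB cvs] fvs] /=.
  rewrite /minor setDv; congr (_, _); apply/setP => X; rewrite !inE subset0.
  by have [->|] := eqVneq X set0; rewrite //= set0U cards0 eqxx.
rewrite IH // => [|V Vvs]; last by apply: fvs; rewrite inE Vvs orbT.
apply: free_product_minors => //; first by apply: fvs; rewrite mem_head.
  exact: subchain_last cvs.
by have /fvs[] := mem_last B vs.
Qed.

(** Peel off the first factor [P]. Its ground set is a free separator of the minor above [A], so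
    [A :|: ground P] is one of [M], and the other factors multiply to the minor above that set. *)
Lemma free_product_seq_chain M A Ms : is_matroid M -> free_separator M A ->
  (forall N, N \in Ms -> is_matroid N) -> disjoint_grounds Ms ->
  free_product_seq Ms = minor M A (ground M) ->
  exists vs, [/\ subchain A vs, last A vs = ground M, Ms = pairmap (minor M) A vs &
                 forall V, V \in vs -> free_separator M V].
Proof.
move=> matM; elim: Ms A => [|P Ms IH] A fA matMs dMs eMs.
  exists [::]; split=> //=; apply/eqP; rewrite eqEsubset (proj1 fA) -setD_eq0.
  by move/(congr1 (@ground T)): eMs => /= <-.
have matP := matMs P (mem_head _ _).
have matMs' N : N \in Ms -> is_matroid N by move=> h; apply: matMs; rewrite inE h orbT.
have matN := minor_matroid matM A (ground M).
have [eP eQ fP] := free_product_factors matN matP (free_product_seq_indep0 matMs')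
   (@free_product_seq_indep_sub Ms) (disjoint_free_product_seq dMs) eMs.
have sP : ground P \subset ground M :\: A := proj1 fP.
have fAP : free_separator M (A :|: ground P).
  by apply: minor_free_separator fP => //; [apply: free_separator_ground | case: fA].
have dMs' : disjoint_grounds Ms by case/andP: dMs.
have eAg : A :|: ground M :\: A = ground M by have sA := proj1 fA; set_eq.
have [|vs [cvs lvs eMs' fvs]] := IH _ fAP matMs' dMs'.
  by rewrite eQ minor_minor // eAg.
exists (A :|: ground P :: vs); split=> //=.
- by rewrite subsetUl.
- by rewrite -eMs' {1}eP minor_minor ?sub0set // setU0.
by move=> V; rewrite inE => /orP[/eqP ->|/fvs].
Qed.

Lemma disjoint_grounds_minors M A vs : subchain A vs ->
  disjoint_grounds (pairmap (minor M) A vs).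
Proof.
rewrite /disjoint_grounds; elim: vs A => //= B vs IH A /andP[sAB cvs]; rewrite IH // andbT.
suff key C : B \subset C -> subchain C vs ->
    all (fun N => [disjoint B :\: A & ground N]) (pairmap (minor M) C vs).
  exact: key.
elim: vs {IH cvs} C => //= D vs IH C sBC /andP[sCD cvs].
rewrite IH ?(subset_trans sBC) // andbT disjoints_subset.
by set_sub.
Qed.

(** Indices count terms of [A :: vs], so factor [i] runs from term [i] to term [i.+1] and a block of
    factors telescopes to one minor. *)
Lemma free_product_seq_slice M A vs i j : is_matroid M -> subchain A vs ->
  (forall V, V \in vs -> free_separator M V) -> i <= j <= size vs ->
  free_product_seq (take (j - i) (drop i (pairmap (minor M) A vs))) =
  minor M (nth A (A :: vs) i) (nth A (A :: vs) j).
Proof.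
move=> matM cvs fvs /andP[leij lej].
have last_take k : k <= size vs -> last A (take k vs) = nth A (A :: vs) k.
  case: k => [|k] lek; first by rewrite take0.
  by rewrite (last_nth A) size_takel //= nth_take.
have drop_pm k (f : {set T} -> {set T} -> matroid T) B us :
    k <= size us -> drop k (pairmap f B us) = pairmap f (last B (take k us)) (drop k us).
  by move=> lek; rewrite -{1}(cat_take_drop k us) pairmap_cat drop_size_cat //
       size_pairmap size_takel.
have take_pm k (f : {set T} -> {set T} -> matroid T) B us :
    k <= size us -> take k (pairmap f B us) = pairmap f B (take k us).
  by move=> lek; rewrite -{1}(cat_take_drop k us) pairmap_cat take_size_cat //
       size_pairmap size_takel.
rewrite drop_pm ?(leq_trans leij) // take_pm; last by rewrite size_drop leq_sub2r.
have := cvs; rewrite /subchain -{1}(cat_take_drop i vs) cat_path => /andP[_ cd].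
rewrite free_product_seq_minors //; first last.
- by move=> V /mem_take/mem_drop/fvs.
- exact: take_path.
by rewrite -last_cat -takeD subnKC // !last_take // (leq_trans leij).
Qed.

End Products.

(** * Intervals between consecutive pinchpoints *)

Section Gaps.
Variables (T : finType) (M : matroid T).
Hypothesis matM : is_matroid M.
Implicit Types (A B U V W X Y Z : {set T}) (vs : seq {set T}).

Lemma pinchpoint_free_separator X : pinchpoint M X -> free_separator M X.
Proof.
move=> [DX cX]; apply: comparable_free_separator => //; exact: in_D_sub_ground.
Qed.

(** Otherwise, for [x] in [B] outside [X], adding [x] to [A] would give a free separator of [M], but
    that set is incomparable to [X]. *)
Lemma nonuniform_minor A B X : free_separator M A -> free_separator M B ->
  A \proper X -> X \proper B -> in_D M X -> ~ uniform (minor M A B).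
Proof.
move=> fA fB /properP[sAX [a aX aA]] /properP[sXB [x xB xX]] DX uAB.
have xA : x \notin A by apply: contra xX; apply: (subsetP sAX).
have sx : [set x] \subset ground (minor M A B) by rewrite sub1set inE xA.
have fx := uniform_free_separator (minor_matroid matM A B) uAB sx.
have fAx := minor_free_separator matM fA fB (subset_trans sAX sXB) fx.
case: (free_separator_comparable matM fAx DX) => /subsetP h.
  by have := h x; rewrite !inE eqxx orbT (negbTE xX) => /(_ isT).
have := h a aX; rewrite !inE (negbTE aA) /= => /eqP eax.
by rewrite -eax aX in xX.
Qed.

Lemma reducible_minor A B V : free_separator M B -> free_separator M V ->
  A \proper V -> V \proper B -> ~ irreducible (minor M A B).
Proof.
move=> fB fV pAV pVB [_ irr].
have [sAV [v vV vA]] := properP pAV; have [sVB [b bB bV]] := properP pVB.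
have cAB : subchain A [:: V; B] by rewrite /subchain /= sAV sVB.
have /irr : is_factorization (pairmap (minor M) A [:: V; B]) (minor M A B).
  split; first last.
  - by rewrite free_product_seq_minors // => W; rewrite !inE => /orP[]/eqP ->.
  - exact: disjoint_grounds_minors.
  - by move=> N; rewrite !inE => /orP[]/eqP ->; apply: minor_matroid.
rewrite !inE => /orP[]/eqP/(congr1 (@ground T))/setP/=.
  move/(_ b); rewrite !inE bB (negbTE bV) andbF andbT.
  by move/negbFE/(subsetP sAV); rewrite (negbTE bV).
by move/(_ v); rewrite !inE vV (negbTE vA) (subsetP sVB).
Qed.

(** Membership in D(M) is a [Prop], so the greatest element is found by running through all sets
    with a classical case split. It is used for inclusion and for reverse inclusion. *)
Lemma directed_greatest (R : rel {set T}) (P : {set T} -> Prop) X0 :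
  reflexive R -> transitive R -> P X0 ->
  (forall X Y, P X -> P Y -> exists Z, [/\ P Z, R X Z & R Y Z]) ->
  exists2 X, P X & forall Y, P Y -> R Y X.
Proof.
move=> Rxx Rtr P0 dir.
suff [X PX maxX] : exists2 X, P X & forall Y, Y \in enum {: {set T}} -> P Y -> R Y X.
  by exists X => // Y; apply: maxX; rewrite mem_enum.
elim: (enum _) => [|Z s [X PX maxX]]; first by exists X0.
have [PZ|nPZ] := classic (P Z); last first.
  by exists X => // Y; rewrite inE => /orP[/eqP -> //|]; exact: maxX.
have [W [PW RZW RXW]] := dir _ _ PZ PX.
exists W => // Y; rewrite inE => /orP[/eqP -> //|Ys PY].
by apply: Rtr RXW; apply: maxX.
Qed.

(* The largest member of D(M) below V and the smallest one above V are
   pinchpoints, hence no member of D(M) lies strictly between A and B. *)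
Lemma uniform_gap A B V : (forall X, pinchpoint M X -> X \subset A \/ B \subset X) ->
  pinchpoint M A -> pinchpoint M B -> free_separator M V ->
  A \proper V -> V \proper B -> uniform (minor M A B).
Proof.
move=> gap pA pB fV pAV pVB.
have cV := free_separator_comparable matM fV; have sV := proj1 fV.
have [sAV [v vV vA]] := properP pAV; have [sVB [b bB bV]] := properP pVB.
have [||||X [DX sXV] maxX] := @directed_greatest (fun X Y => X \subset Y)
  (fun X => in_D M X /\ X \subset V) set0.
- by move=> Y; apply: subxx.
- by move=> Y X Z; apply: subset_trans.
- by split; [apply: D_empty | apply: sub0set].
- move=> X Y [DX sX] [DY sY]; exists (X :|: Y); split; rewrite ?subsetUl ?subsetUr //.
  by split; [apply: D_union | rewrite subUset sX].
have [||||Y [DY sVY] minY] := @directed_greatest (fun X Y => Y \subset X)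
  (fun X => in_D M X /\ V \subset X) (ground M).
- by move=> Y; apply: subxx.
- by move=> Y Z W sYZ sWY; apply: subset_trans sWY sYZ.
- by split; [apply: D_full | ].
- move=> Y Z [DY sY] [DZ sZ]; exists (Y :&: Z); split; rewrite ?subsetIl ?subsetIr //.
  by split; [apply: D_inter | rewrite subsetI sY].
have sXA : X \subset A.
  have [|//|sBX] := gap X; last by have := subsetP sXV b (subsetP sBX b bB); rewrite (negbTE bV).
  split=> // Z DZ; case: (cV Z DZ) => h; last by right; apply: maxX.
  by left; apply: subset_trans sXV h.
have sBY : B \subset Y.
  have [|sYA|//] := gap Y; last by have := subsetP sYA v (subsetP sVY v vV); rewrite (negbTE vA).
  split=> // Z DZ; case: (cV Z DZ) => h; first by left; apply: minY.
  by right; apply: subset_trans h sVY.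
have fB := pinchpoint_free_separator pB.
have sAB := subset_trans sAV sVB.
apply: free_separator_uniform; first exact: minor_matroid.
move=> U /= sU; have eU : U = (A :|: U) :\: A by set_eq.
have sAUB : A :|: U \subset B by rewrite subUset sAB (subset_trans sU (subsetDl _ _)).
rewrite eU; apply: free_separator_minor => //; [|exact: subsetUl|exact: proj1 fB].
apply: comparable_free_separator => //; first exact: subset_trans (proj1 fB).
(* A member of D(M) above [V] contains [Y], hence [B]; one below [V] lies in [X], hence in [A].
   Either way it is comparable to [A :|: U]. *)
move=> Z DZ; case: (cV Z DZ) => h.
  by left; apply: subset_trans sAUB (subset_trans sBY _); apply: minY.
by right; apply: subset_trans (subsetUl _ _); apply: subset_trans sXA; apply: maxX.
Qed.

(** A factorization is a chain of free separators of the minor; these lift to [M], so each is empty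
    or the whole ground set. *)
Lemma irreducible_gap A B : free_separator M A -> free_separator M B -> A \proper B ->
  (forall V, free_separator M V -> A \proper V -> ~~ (V \proper B)) ->
  irreducible (minor M A B).
Proof.
move=> fA fB pAB gap; have [sAB [b bB bA]] := properP pAB.
have nz : ground (minor M A B) != set0 by apply/set0Pn; exists b; rewrite inE bA.
split=> // Ms [matMs dMs eMs].
have matN := minor_matroid matM A B; set N := minor M A B in matN eMs nz *.
have [|vs [cvs lvs -> fvs]] :=
    free_product_seq_chain matN (free_separator0 N) matMs dMs.
  by rewrite minor_ground.
have triv V : V \in vs -> V = set0 \/ V = ground N.
  move=> Vvs; have fV := fvs V Vvs; have sV : V \subset B :\: A := proj1 fV.
  have [->|/set0Pn[v vV]] := eqVneq V set0; [by left | right].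
  have fAV := minor_free_separator matM fA fB sAB fV.
  have pA : A \proper A :|: V.
    rewrite properE subsetUl; apply/subsetPn; exists v; first by rewrite inE vV orbT.
    by have := subsetP sV v vV; rewrite inE => /andP[].
  have := gap _ fAV pA; rewrite properE subUset sAB (subset_trans sV (subsetDl _ _)) /=.
  by rewrite negbK => sBAV; apply/eqP; rewrite eqEsubset sV /=; set_sub.
(* Skip the initial empty terms: the first term equal to the ground set contributes [N] itself as a
   factor. *)
elim: vs cvs lvs triv {fvs matMs dMs eMs Ms} => [_ /= e|V vs IH /= cvs lvs triv].
  by case/eqP: nz; apply: esym e.
case: (triv V (mem_head _ _)) => eV; last by rewrite eV minor_ground // mem_head.
rewrite inE; apply/orP; right; rewrite eV in lvs cvs *.
apply: IH => // [|W Wvs]; first by case/andP: cvs.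
by apply: triv; rewrite inE Wvs orbT.
Qed.
End Gaps.

(** * Indexing in chains of sets *)

Section Chains.
Variable T : finType.
Implicit Types (A B V : {set T}) (vs : seq {set T}).

Lemma proper_chain_subchain A vs :
  path (fun A B : {set T} => A \proper B) A vs -> subchain A vs.
Proof. by apply: sub_path => X Y; apply: proper_sub. Qed.

Lemma subchain_nth A vs i j : subchain A vs -> i <= j <= size vs ->
  nth A (A :: vs) i \subset nth A (A :: vs) j.
Proof.
move=> cvs /andP[leij lej].
have tr : transitive (fun X Y : {set T} => X \subset Y) by move=> Y X Z; apply: subset_trans.
apply: (sorted_leq_nth tr (fun X => subxx X) A (s := A :: vs)) => //; rewrite inE /= ltnS //.
exact: leq_trans lej.
Qed.

Lemma chain_nth_proper A vs i : path (fun A B : {set T} => A \proper B) A vs -> i < size vs ->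
  nth A (A :: vs) i \proper nth A (A :: vs) i.+1.
Proof. by move=> /(pathP A) h /h. Qed.

Lemma chain_gap A vs V : path (fun A B : {set T} => A \proper B) A vs ->
  A \subset V -> V \subset last A vs ->
  (forall X, X \in vs -> V \subset X \/ X \subset V) -> V \notin A :: vs ->
  exists i, [/\ i < size vs, nth A (A :: vs) i \proper V & V \proper nth A (A :: vs) i.+1].
Proof.
elim: vs A => [A _ sAV sVA _|B vs IH A /= /andP[pAB pvs] sAV sVl cmpV].
  by rewrite inE eqEsubset sAV sVA.
rewrite in_cons negb_or => /andP[neA nin].
have neB : V != B by apply: contraNneq nin => ->; rewrite mem_head.
have [sVB|sBV] := cmpV B (mem_head _ _).
  by exists 0; split; rewrite //= properEneq ?neB // eq_sym neA.
have [|i [lti p1 p2]] := IH B pvs sBV sVl _ nin.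
  by move=> X Xvs; apply: cmpV; rewrite inE Xvs orbT.
(* The induction hypothesis uses [B] as the default of [nth]. *)
have eAB k : k <= size vs -> nth A (B :: vs) k = nth B (B :: vs) k.
  by move=> lek; apply: set_nth_default.
exists i.+1; split; rewrite // -[nth A _ _]/(nth A (B :: vs) _) eAB //.
exact: ltnW.
Qed.

Lemma minor_chainP (M N : matroid T) A vs : reflect
  (exists2 i, i < size vs & N = minor M (nth A (A :: vs) i) (nth A (A :: vs) i.+1))
  (N \in pairmap (minor M) A vs).
Proof.
apply: (iffP (nthP (minor M A A))) => [[i]|[i lti ->]].
  by rewrite size_pairmap => lti <-; exists i; rewrite ?(nth_pairmap A).
by exists i; rewrite ?size_pairmap ?(nth_pairmap A).
Qed.
End Chains.

(** * Existence and uniqueness of the primary factorization *)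

Theorem theorem6p16 (T : finType) (M : matroid T)
    (t0 : {set T}) (rest : seq {set T}) :
  is_matroid M ->
  primary_flag M (t0 :: rest) ->
  forall Ms : seq (matroid T),
    [/\ forall N : matroid T, N \in Ms -> is_matroid N /\ ground N != set0,
        disjoint_grounds Ms,
        free_product_seq Ms = M,
        forall N : matroid T, N \in Ms -> irreducible N \/ uniform N &
        forall i j, i + 2 <= j <= size Ms ->
          ~ uniform (free_product_seq (take (j - i) (drop i Ms)))]
    <-> Ms = pairmap (minor M) t0 rest.
Proof.
move=> matM [sts pts] Ms; have {}sts : path (fun A B : {set T} => A \proper B) t0 rest := sts.
have cts := proper_chain_subchain sts.
have pp i : i <= size rest -> pinchpoint M (nth t0 (t0 :: rest) i).
  by move=> lei; apply/pts; rewrite mem_nth.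
have pp_nth X : pinchpoint M X -> exists2 i, i <= size rest & nth t0 (t0 :: rest) i = X.
  by move=> /pts /(nthP t0)[i]; exists i.
have p0 : pinchpoint M set0 by split=> [|Y _]; [apply: D_empty | left; apply: sub0set].
have pg : pinchpoint M (ground M).
  by split=> [|Y DY]; [apply: D_full | right; apply: in_D_sub_ground].
have et0 : t0 = set0.
  have [i lei e] := pp_nth _ p0; apply/eqP; rewrite -subset0 -e.
  exact: (@subchain_nth _ t0 rest 0 i).
have ltl : last t0 rest = ground M.
  have sl : last t0 rest \subset ground M.
    by rewrite (last_nth t0); apply: in_D_sub_ground; case: (pp (size rest)).
  have [i lei e] := pp_nth _ pg; apply/eqP; rewrite eqEsubset sl -e (last_nth t0).
  by apply: subchain_nth; rewrite // lei leqnn.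
have fts V : V \in rest -> free_separator M V.
  by move=> Vr; apply: pinchpoint_free_separator => //; apply/pts; rewrite inE Vr orbT.
have ft i : i <= size rest -> free_separator M (nth t0 (t0 :: rest) i).
  by move=> lei; apply: pinchpoint_free_separator => //; apply: pp.
have gap i : i < size rest -> forall X, pinchpoint M X ->
    X \subset nth t0 (t0 :: rest) i \/ nth t0 (t0 :: rest) i.+1 \subset X.
  move=> lti X /pp_nth [k lek <-]; case: (leqP k i) => h; [left | right];
    by apply: subchain_nth; rewrite // h ?(ltnW lti).
have unif i V : i < size rest -> free_separator M V ->
    nth t0 (t0 :: rest) i \proper V -> V \proper nth t0 (t0 :: rest) i.+1 ->
    uniform (minor M (nth t0 (t0 :: rest) i) (nth t0 (t0 :: rest) i.+1)).
  move=> lti; apply: uniform_gap => //; [exact: gap | exact/pp/ltnW | exact: pp].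
split=> [[matMs dMs eMs irrMs nunif]|->].
  have [|vs [cvs lvs eMs' fvs]] :=
    free_product_seq_chain matM (free_separator0 M) (fun N h => proj1 (matMs N h)) dMs.
    by rewrite minor_ground.
  rewrite et0 {Ms} eMs' in matMs dMs eMs irrMs nunif *.
  (* The chain is strict because the factors are nonempty. *)
  have svs : path (fun A B : {set T} => A \proper B) set0 vs.
    apply/(pathP set0) => i lti.
    have sub : nth set0 (set0 :: vs) i \subset nth set0 vs i by move/(pathP set0): cvs; apply.
    have [|_] := matMs (minor M (nth set0 (set0 :: vs) i) (nth set0 vs i)).
      by apply/minor_chainP; exists i.
    by rewrite /= setD_eq0 properE sub.
  have fv i : i <= size vs -> free_separator M (nth set0 (set0 :: vs) i).
    by case: i => [_|i lti]; [apply: free_separator0 | exact: fvs (mem_nth set0 lti)].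
  have ptr : transitive (fun A B : {set T} => A \proper B).
    by move=> Y X Z; apply: proper_trans.
  (* A missing pinchpoint would lie strictly inside some factor, which could then be neither
     irreducible nor uniform. *)
  have pin_vs X : pinchpoint M X -> X \in set0 :: vs.
    move=> pX; apply: contraT => /(chain_gap svs (sub0set X)).
    rewrite lvs => /(_ (in_D_sub_ground (proj1 pX))) [].
      by move=> V /fvs fV; case: (free_separator_comparable matM fV (proj1 pX)); [right | left].
    move=> i [lti pA pB].
    have [|irr|uni] := irrMs (minor M (nth set0 (set0 :: vs) i) (nth set0 (set0 :: vs) i.+1)).
    - by apply/minor_chainP; exists i.
    - case: (reducible_minor matM _ _ pA pB irr); first exact: fv.
      exact: pinchpoint_free_separator.
    case: (nonuniform_minor matM _ _ pA pB (proj1 pX) uni); apply: fv => //.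
    exact: ltnW.
  (* A term [V] outside the flag lies strictly between two consecutive pinchpoints. These are terms
     [j] and [k] of the chain and [V] is a term [m] between them, so a block of at least two factors
     has a uniform product. *)
  have vs_pin V : V \in set0 :: vs -> V \in t0 :: rest.
    move=> Vin; have fV : free_separator M V.
      by move: Vin; rewrite inE => /orP[/eqP ->|/fvs //]; apply: free_separator0.
    have VM := proj1 fV.
    apply: contraT => /(chain_gap sts); rewrite ltl et0 sub0set VM => /(_ isT isT) [].
      move=> X Xr; have /pts[DX _] : X \in t0 :: rest by rewrite inE Xr orbT.
      exact: free_separator_comparable fV _ DX.
    rewrite -et0 => i [lti pA pB].
    have /(nthP set0)[j ltj ej] := pin_vs _ (pp i (ltnW lti)).
    have /(nthP set0)[k ltk ek] := pin_vs _ (pp i.+1 lti).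
    have /(nthP set0)[m ltm em] := Vin.
    rewrite /= !ltnS in ltj ltk ltm.
    have lt_of a b : a <= size vs ->
        nth set0 (set0 :: vs) a \proper nth set0 (set0 :: vs) b -> a < b.
      move=> lea; rewrite properE ltnNge => /andP[_]; apply: contra => leba.
      by apply: subchain_nth; rewrite // leba.
    have jm : j < m by apply: lt_of; rewrite // ej em.
    have mk : m < k by apply: lt_of; rewrite // ek em.
    case: (nunif j k); first by rewrite size_pairmap ltk addn2 (leq_ltn_trans jm mk).
    rewrite free_product_seq_slice //; last by rewrite ltk (ltnW (ltn_trans jm mk)).
    by rewrite ej ek; apply: unif pA pB.
  suff [_ ->] : t0 :: rest = set0 :: vs by [].
  (* Strictly increasing sequences with the same members coincide. *)
  apply: (irr_sorted_eq ptr (fun X => properxx X)) => // X.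
  by apply/idP/idP => [/pts/pin_vs|/vs_pin].
have fpsM : free_product_seq (pairmap (minor M) t0 rest) = M.
  by rewrite free_product_seq_minors // ltl et0 minor_ground.
split=> //.
- move=> N /minor_chainP[i lti ->]; split; first exact: minor_matroid.
  by have := chain_nth_proper sts lti; rewrite properE /= setD_eq0 => /andP[].
- exact: disjoint_grounds_minors.
- move=> N /minor_chainP[i lti ->].
  set A := nth t0 _ i; set B := nth t0 _ i.+1.
  have [[V [fV pA pB]]|noV] :=
    classic (exists V, [/\ free_separator M V, A \proper V & V \proper B]).
    by right; apply: unif pA pB.
  left; apply: (irreducible_gap matM (ft _ (ltnW lti)) (ft _ lti) (chain_nth_proper sts lti)).
  by move=> V fV pA; apply/negP => pB; apply: noV; exists V.
move=> i j; rewrite size_pairmap addn2 => /andP[ltij lej].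
rewrite free_product_seq_slice //; last by rewrite lej (ltnW (ltnW ltij)).
have lti : i < size rest by apply: leq_trans lej; apply: ltnW.
(* A block of two or more factors has the pinchpoint [i.+1] strictly inside it. *)
apply: (@nonuniform_minor _ _ matM _ _ (nth t0 (t0 :: rest) i.+1)); rewrite //.
- by apply: ft; apply: ltnW.
- exact: ft.
- exact: chain_nth_proper.
- apply: proper_sub_trans (chain_nth_proper sts _) _; first exact: leq_trans lej.
  by apply: subchain_nth; rewrite // ltij.
by case: (pp i.+1 lti).
Qed.
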